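(* Let $X$ be a Hausdorff topological space, let $T:X\to X$ be a continuous map, let $(x_n)_{n\in\mathbb{N}}$ be a sequence in $X$, and let $c\in\{0,1,2,\ldots,\infty\}$. Let $$\mathrm{coGap}_c:=\{S\subseteq\mathbb{N}\mid \mathrm{coGap}(S)\ge c\}$$ (an eventual family of subsets of $\mathbb{N}$), and let $L:X\to\{0,1,\ldots,\infty\}$ be the $\mathrm{coGap}$-limit of the sequence, $$L(x):=\min\{\mathrm{coGap}(\{n\in\mathbb{N}\mid x_n\in U\})\mid U\subseteq X\text{ open},\ x\in U\}.$$ If $(x_n)_{n\in\mathbb{N}}$ follows $T$ with respect to $\mathrm{coGap}_c$, then every point of the level set $\{x\in X\mid L(x)\ge c\}$ is a fixed point of $T$.
   Context: $\mathbb{N}$ denotes the positive integers. For $S\subseteq\mathbb{N}$ infinite, write $S=\{n_1^S<n_2^S<\cdots\}$ and set $$\mathrm{Gap}(S):=\limsup_{k\to\infty}\,(n_{k+1}^S-n_k^S-1)\in\{0,1,\ldots,\infty\};$$ for $S$ finite set $\mathrm{Gap}(S):=\infty$. Define $\mathrm{coGap}(S):=\mathrm{Gap}(\mathbb{N}\setminus S)$ for every $S\subseteq\mathbb{N}$. The function $\mathrm{coGap}$ is increasing with respect to inclusion. A family $\mathcal{E}$ of subsets of $\mathbb{N}$ is called an eventual family if $S\in\mathcal{E}$ and $S\subseteq S'\subseteq\mathbb{N}$ imply $S'\in\mathcal{E}$. The sequence $(x_n)_{n\in\mathbb{N}}$ follows $T$ with respect to an eventual family $\mathcal{E}$ if for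 every $S\in\mathcal{E}$ there are integers $p,q\in S$ such that $x_p=T(x_q)$. *)

(* Defs.v *)
From mathcomp Require Import all_boot all_order all_algebra.
From mathcomp Require Import all_classical all_reals all_analysis.

Set Implicit Arguments.
Unset Strict Implicit.
Unset Printing Implicit Defensive.

Import Order.TTheory GRing.Theory Num.Theory.
Import numFieldNormedType.Exports.

Local Open Scope classical_set_scope.
Local Open Scope ring_scope.
Local Open Scope ereal_scope.

(* The positive integers, as a subset of nat. Sets of indices are subsets of
   Npos, and the value at 0 of a sequence [x : nat -> X] is never used. *)
Definition Npos : set nat := [set n | (0 < n)%N].

(* The extended natural numbers {0, 1, ..., +oo} inside \bar R. *)
Definition enat (R : realType) : set (\bar R) :=
  [set m | m = +oo \/ exists n : nat, m = n%:R%:E].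

(* [enumeration S k] is the element of rank k (counted from 0) of an infinite
   set S; the default value is irrelevant for S infinite, see
   [enumerationP]. *)
Definition enumeration (S : set nat) : nat -> nat :=
  xget (id : nat -> nat) [set f | increasing_seq f /\ range f = S].

Definition Gap (R : realType) (S : set nat) : \bar R :=
  if `[< infinite_set S >] then
    limn_esup (fun k =>
      (enumeration S k.+1 - enumeration S k - 1)%N%:R%:E)
  else +oo.

Definition coGap (R : realType) (S : set nat) : \bar R := Gap R (Npos `\` S).

Definition eventual_family (E : set (set nat)) : Prop :=
  (forall S, E S -> S `<=` Npos) /\
  (forall S S', E S -> S `<=` S' -> S' `<=` Npos -> E S').

Definition follows (X : Type) (x : nat -> X) (T : X -> X) (E : set (set nat)) :
    Prop :=
  forall S, E S -> exists p q, [/\ S p, S q & x p = T (x q)].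

Definition coGap_ge (R : realType) (c : \bar R) : set (set nat) :=
  [set S | S `<=` Npos /\ c <= coGap R S].

(* The least element of A; the default value is irrelevant for nonempty sets of
   extended natural numbers, see [eminP]. *)
Definition emin (R : realType) (A : set (\bar R)) : \bar R :=
  xget +oo [set m | A m /\ lbound A m].

Definition coGap_limit (R : realType) (X : topologicalType) (x : nat -> X)
    (y : X) : \bar R :=
  emin [set coGap R [set n | Npos n /\ U (x n)] | U in [set U | open U /\ U y]].

Lemma enumerationP (S : set nat) : infinite_set S ->
  increasing_seq (enumeration S) /\ range (enumeration S) = S.
Proof.
move=> Sinf.
have nextP m : exists n, `[< S n >] && (m <= n)%N.
  apply: contrapT => h; apply: Sinf; apply: (sub_finite_set _ (finite_II m)).
  move=> n Sn /=; rewrite ltnNge; apply/negP => mn; apply: h.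
  by exists n; rewrite mn andbT; apply/asboolP.
pose next m := ex_minn (nextP m).
have nextS m : [/\ S (next m), (m <= next m)%N &
    forall n, S n -> (m <= n)%N -> (next m <= n)%N].
  rewrite /next; case: ex_minnP => n /andP[/asboolP Sn mn] min; split=> //.
  by move=> k Sk mk; apply: min; rewrite mk andbT; apply/asboolP.
pose f := fix f k := if k is k'.+1 then next (f k').+1 else next 0%N.
suff fP : [set f | increasing_seq f /\ range f = S] f by exact: (xgetI (id : nat -> nat) fP).
have fS k : S (f k) by case: k => [|k] /=; [case: (nextS 0%N)|case: (nextS (f k).+1)].
have fincr : increasing_seq f.
  by apply/increasing_seqP => k; rewrite ltEnat /=; case: (nextS (f k).+1).
split=> //; apply/seteqP; split=> [_ [k _ <-]//|n Sn].
have fge k : (k <= f k)%N.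
  elim: k => // k ih; apply: leq_ltn_trans ih _ => /=.
  by case: (nextS (f k).+1).
have : exists k, (n <= f k)%N by exists n.
move=> /ex_minnP[k nk min]; exists k => //; apply/eqP; rewrite eqn_leq nk andbT.
case: k nk min => [|k] nk min /=; first by case: (nextS 0%N) => _ _; apply.
case: (nextS (f k).+1) => _ _; apply => //; rewrite ltnNge; apply/negP => h.
by have := min _ h; rewrite ltnn.
Qed.

Section facts.
Variable R : realType.
Implicit Types (S : set nat) (m : nat).

Lemma limn_esup_nat_lt (u : nat -> nat) m :
  limn_esup (fun k => (u k)%:R%:E : \bar R) < m.+1%:R%:E ->
  exists N, forall k, (N <= k)%N -> (u k <= m)%N.
Proof.
move=> /ereal_inf_lt[_ [V [N _ NV] <-]] lt; exists N => k Nk.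
rewrite -ltnS -(ltr_nat R) -lte_fin; apply: le_lt_trans lt.
by apply: ereal_sup_ubound; exists k => //; exact: NV.
Qed.

Lemma limn_esup_nat_le (u : nat -> nat) m :
  (exists N, forall k, (N <= k)%N -> (u k <= m)%N) ->
  limn_esup (fun k => (u k)%:R%:E : \bar R) <= m%:R%:E.
Proof.
move=> [N h].
apply: (@le_trans _ _ (ereal_sup ((fun k => (u k)%:R%:E : \bar R) @` [set k | (N <= k)%N]))).
  by apply: ereal_inf_lbound; exists [set k | (N <= k)%N] => //; exists N.
apply: ge_ereal_sup => _ [k /= Nk <-]; rewrite lee_fin ler_nat; exact: h.
Qed.

Let syndetic S m :=
  exists N, forall n, (N <= n)%N -> exists2 s, S s & (n <= s <= n + m)%N.

Let syndetic_infinite S m : syndetic S m -> infinite_set S.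
Proof.
move=> [N h] /finite_seqP[s Ss].
have [t] := h (maxn N (\max_(i <- s) i).+1)%N (leq_maxl _ _).
rewrite Ss /= => ts /andP[]; rewrite geq_max => /andP[_ lt] _.
by move: lt; rewrite ltnNge (leq_bigmax_seq _ ts).
Qed.

Let syndeticP S m : infinite_set S -> syndetic S m <->
  exists N, forall k, (N <= k)%N ->
    (enumeration S k.+1 - enumeration S k - 1 <= m)%N.
Proof.
move=> /enumerationP; set f := enumeration S => -[fincr fS].
have flt k : (f k < f k.+1)%N by move/increasing_seqP: fincr => /(_ k); rewrite ltEnat.
have fmono i j : (f i <= f j)%N = (i <= j)%N by exact: fincr.
have fge k : (k <= f k)%N by elim: k => // k ih; exact: leq_ltn_trans ih (flt k).
split=> -[N h].
  exists N => k Nk.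
  have [s] := h (f k).+1 (leq_trans Nk (leq_trans (fge k) (leqnSn _))).
  rewrite -fS => -[j _ <-] /andP[kj jm].
  have : (f k.+1 <= f j)%N by rewrite fmono ltnNge -fmono -ltnNge.
  move=> /leq_trans/(_ jm); rewrite addSn => le.
  by rewrite -subnDA addn1 leq_subLR addSn.
exists (f N).+1 => n Nn.
have : exists k, (n <= f k)%N by exists n.
move=> /ex_minnP[[|k] nk min].
  by have := leq_trans Nn nk; rewrite ltnNge fmono leq0n.
exists (f k.+1); first by rewrite -fS; exists k.+1.
have kn : (f k < n)%N by rewrite ltnNge; apply/negP => /min; rewrite ltnn.
have Nk : (N <= k)%N by rewrite -ltnS ltnNge -fmono -ltnNge; exact: leq_trans Nn nk.
have := h _ Nk; rewrite nk /= -subnDA addn1 leq_subLR addSn => /leq_trans; apply.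
by rewrite -addSn leq_add2r.
Qed.

Let Gap_lt_syndetic S m : Gap R S < m.+1%:R%:E -> syndetic S m.
Proof.
rewrite /Gap; case: asboolP => [Sinf|_]; last by rewrite ltNge leey.
by move=> /limn_esup_nat_lt; rewrite syndeticP.
Qed.

Let syndetic_Gap_le S m : syndetic S m -> Gap R S <= m%:R%:E.
Proof.
move=> h; have Sinf := syndetic_infinite h.
by rewrite /Gap asboolT//; apply: limn_esup_nat_le; apply/syndeticP.
Qed.

Let Gap_ge0 S : 0 <= Gap R S.
Proof.
rewrite /Gap; case: ifP => // _; apply: le_ereal_inf_tmp => _ [V [N _ NV] <-].
apply: le_ereal_sup_tmp; eexists; first by exists N => //; apply: NV => /=.
by rewrite lee_fin.
Qed.

Lemma Gap_enat S : enat (Gap R S).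
Proof.
have [h|h] := pselect (exists m, `[< Gap R S < m.+1%:R%:E >]).
  right; have [m /asboolP lt min] := ex_minnP h; exists m; apply/le_anti.
  rewrite (syndetic_Gap_le (Gap_lt_syndetic lt)) /=.
  case: m min lt => [|m] min lt; first exact: Gap_ge0.
  by rewrite leNgt; apply/negP => /asboolP/min; rewrite ltnn.
left; apply/eqP; rewrite eq_le leey /=.
have : forall m : nat, m.+1%:R%:E <= Gap R S.
  move=> m; rewrite leNgt; apply/negP => lt; apply: h.
  by exists m; apply/asboolP.
have := Gap_ge0 S; case: (Gap R S) => [r|//|//] r0 /(_ (Num.bound r)).
rewrite lee_fin leNgt => /negP[]; rewrite lee_fin in r0.
apply: (lt_trans (archi_boundP r0)); by rewrite ltr_nat.
Qed.

Lemma le_Gap S S' : S `<=` S' -> Gap R S' <= Gap R S.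
Proof.
move=> SS'; have [->|[m e]] := Gap_enat S; first by rewrite leey.
rewrite e; apply: syndetic_Gap_le.
have : syndetic S m by apply: Gap_lt_syndetic; rewrite e lte_fin ltr_nat.
by move=> [N h]; exists N => n /h[s /SS' ? ?]; exists s.
Qed.

Lemma le_coGap S S' : S `<=` S' -> coGap R S <= coGap R S'.
Proof. by move=> SS'; apply: le_Gap; exact: setDS. Qed.

Lemma coGap_ge_eventual (c : \bar R) : eventual_family (coGap_ge c).
Proof.
split=> [S []//|S S' [_ cS] SS' S'N]; split=> //.
exact: le_trans cS (le_coGap SS').
Qed.

Lemma eminP (A : set (\bar R)) : A !=set0 -> A `<=` @enat R ->
  A (emin A) /\ lbound A (emin A).
Proof.
move=> [a Aa] AN.
suff [b bP] : exists b, [set b | A b /\ lbound A b] b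
  by exact: (xgetI +oo bP).
have [An|h] := pselect (exists n : nat, `[< A n%:R%:E >]); last first.
  have Aoo b : A b -> b = +oo.
    move=> Ab; have [//|[n bn]] := AN _ Ab; exfalso; apply: h.
    by exists n; apply/asboolP; rewrite -bn.
  by exists a; split=> // b /Aoo ->; rewrite leey.
have [k /asboolP Ak min] := ex_minnP An.
exists k%:R%:E; split=> // b Ab; have [->|[j bj]] := AN _ Ab; first by rewrite leey.
by rewrite bj lee_fin ler_nat; apply: min; apply/asboolP; rewrite -bj.
Qed.

Lemma coGap_limitP (X : topologicalType) (x : nat -> X) (y : X) :
  let A := [set coGap R [set n | Npos n /\ U (x n)] |
            U in [set U | open U /\ U y]] in
  A (coGap_limit R x y) /\ lbound A (coGap_limit R x y).
Proof.
apply: eminP; last by move=> _ [U _ <-]; exact: Gap_enat.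
by exists (coGap R [set n | Npos n /\ setT (x n)]), setT => //; split; [exact: openT|].
Qed.

End facts.

(* Main.v *)
Require Import Defs.
From mathcomp Require Import all_boot all_order all_algebra.
From mathcomp Require Import all_classical all_reals all_analysis.

Local Open Scope classical_set_scope.
Local Open Scope ereal_scope.

(** If [T y] differs from [y], disjoint open sets [U] and [V] separate them, and by continuity [W],
    the part of [V] sent into [U], is a neighbourhood of [y]. Its visiting times contain [p], [q]
    with [x p = T (x q)], a point of both [U] and [V]. *)

Theorem mainTheorem3 (R : realType) (X : topologicalType) (T : X -> X)
    (x : nat -> X) (c : \bar R) :
  hausdorff_space X -> continuous T -> enat c ->
  follows x T (coGap_ge c) ->
  [set y | c <= coGap_limit R x y] `<=` [set y | T y = y].
Proof.
rewrite open_hausdorff => sepX contT _ xT y /= cy.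
apply: contrapT => /eqP /sepX[[U V] /= [/set_mem UTy /set_mem Vy]].
move=> [openU openV UV0].
pose W := V `&` T @^-1` U.
have openW : open W.
  by apply: openI => //; apply: open_comp => // z _; exact: contT.
have SW : coGap_ge c [set n | Npos n /\ W (x n)].
  split=> [n []//|]; have [_ lbL] := coGap_limitP R x y.
  (* The limit at [y] bounds from below the [coGap] of the visits to any neighbourhood of [y]. *)
  by apply: (Order.POrderTheory.le_trans cy); apply: lbL; exists W.
have [p [q [[_ [Vp _]] [_ [_ Uq]] pq]]] := xT _ SW.
by have : (U `&` V) (x p); [split=> //; rewrite pq | rewrite (eqP UV0)].
Qed.
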